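(* There exist $C^\infty$ embedded flat Möbius strips in $\mathbb{S}^3$, i.e. there exists a $C^\infty$ embedding of a Möbius strip into $\mathbb{S}^3$ whose induced metric is flat.
   Context: $\mathbb{S}^3$ is the unit sphere of $\mathbb{R}^4$ with its round metric. No completeness of the Möbius strip is required. *)

(* Defs.v *)
(* MathComp-Analysis; [R : realType] is the field of real numbers. *)
From HB Require Import structures.
From mathcomp Require Import all_boot all_order all_algebra.
From mathcomp Require Import all_classical all_reals all_analysis.

Set Implicit Arguments.
Unset Strict Implicit.
Unset Printing Implicit Defensive.

Import Order.TTheory GRing.Theory Num.Theory.
Import numFieldNormedType.Exports.

Local Open Scope classical_set_scope.
Local Open Scope ring_scope.
Local Open Scope quotient_scope.

Section Calculus.
Context {R : realType} {n : nat}.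

Definition partial {V : normedModType R} (i : 'I_n) (f : 'rV[R]_n -> V) :
  'rV[R]_n -> V := fun p => 'D_(delta_mx 0 i) f p.

(* All iterated partial derivatives of order at most [k] exist and are
   continuous on the whole of R^n. *)
Fixpoint Ck {V : normedModType R} (k : nat) (f : 'rV[R]_n -> V) : Prop :=
  continuous f /\
  if k is k'.+1 then
    forall i : 'I_n,
      (forall p, derivable f p (delta_mx 0 i)) /\ Ck k' (partial i f)
  else True.

Definition smooth {V : normedModType R} (f : 'rV[R]_n -> V) : Prop :=
  forall k, Ck k f.

End Calculus.

Definition dot {R : realType} {m : nat} (u v : 'rV[R]_m) : R :=
  \sum_(i < m) u 0 i * v 0 i.

(* The unit sphere S^(m-1) of R^m. *)
Definition sphere (R : realType) (m : nat) : set 'rV[R]_m :=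
  [set x | dot x x = 1].

Arguments sphere : clear implicits.

Section Immersion.
Context {R : realType} {n m : nat}.

(* The differential at every point (its rows are the partial derivatives) is
   injective. *)
Definition immersion (F : 'rV[R]_n -> 'rV[R]_m) : Prop :=
  forall p, row_free (\matrix_(i < n) partial i F p).

(* First fundamental form: the pullback by [F] of the Euclidean metric of R^m.
   As the round metric of the sphere is the restriction of the Euclidean one,
   it is also the metric induced by the sphere when [F] takes its values
   there. *)
Definition induced_metric (F : 'rV[R]_n -> 'rV[R]_m) (p : 'rV[R]_n) :
  'M[R]_n := \matrix_(i, j) dot (partial i F p) (partial j F p).

End Immersion.

Section Curvature.
Context {R : realType} {n : nat}.
Implicit Types g : 'rV[R]_n -> 'M[R]_n.

(* Christoffel symbol of the second kind, with upper index [k]. *)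
Definition christoffel g (k i j : 'I_n) (p : 'rV[R]_n) : R :=
  2^-1 * \sum_(l < n) invmx (g p) k l *
    (partial i (fun q => g q j l) p + partial j (fun q => g q i l) p
     - partial l (fun q => g q i j) p).

(* The component along d_l of
   R(d_i, d_j) d_k = nabla_i nabla_j d_k - nabla_j nabla_i d_k. *)
Definition riemann g (l i j k : 'I_n) (p : 'rV[R]_n) : R :=
  partial i (christoffel g l j k) p - partial j (christoffel g l i k) p
  + \sum_(a < n) (christoffel g l i a p * christoffel g a j k p
                  - christoffel g l j a p * christoffel g a i k p).

Definition flat_metric g : Prop :=
  forall (l i j k : 'I_n) (p : 'rV[R]_n), riemann g l i j k p = 0.

End Curvature.

(* Homeomorphism onto the image, which carries the subspace topology. *)
Definition topological_embedding {X Y : topologicalType} (f : X -> Y) : Prop :=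
  injective f /\
  forall U : set X, open U <-> exists2 V : set Y, open V & f @^-1` V = U.

Section Moebius.
Variable R : realType.

(* The action of Z on R^2 generated by the glide reflection
   (s, t) |-> (s + 1, - t). *)
Definition glide (k : int) (p : 'rV[R]_2) : 'rV[R]_2 :=
  \row_j (if j == 0 then p 0 0 + k%:~R else (-1) ^ k * p 0 1).

Lemma glide0 p : glide 0 p = p.
Proof.
apply/rowP => j; rewrite mxE; case: ifPn => [/eqP ->|j0]; first by rewrite addr0.
rewrite expr0z mul1r; congr (p 0 _).
by apply/val_inj; case: j j0 => -[|[|]].
Qed.

Lemma glideD k l p : glide k (glide l p) = glide (k + l) p.
Proof.
apply/rowP => j; rewrite !mxE /=; case: ifPn => _.
  by rewrite intrD addrAC addrA.
by rewrite mulrA expfzDr // oppr_eq0 oner_eq0.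
Qed.

Definition moebius_rel (p q : 'rV[R]_2) : bool :=
  `[< exists k : int, q = glide k p >].

Lemma moebius_rel_refl : reflexive moebius_rel.
Proof. by move=> p; apply/asboolP; exists 0; rewrite glide0. Qed.

Lemma moebius_rel_sym : symmetric moebius_rel.
Proof.
move=> p q; apply/asboolP/asboolP => -[k ->]; exists (- k);
  by rewrite glideD addNr glide0.
Qed.

Lemma moebius_rel_trans : transitive moebius_rel.
Proof.
move=> q p r /asboolP[k ->] /asboolP[l ->]; apply/asboolP.
by exists (l + k); rewrite glideD.
Qed.

Canonical moebius_equiv := EquivRel moebius_rel
  moebius_rel_refl moebius_rel_sym moebius_rel_trans.

(* The (open) Moebius strip R^2 / <(s, t) |-> (s + 1, - t)>. *)
Definition moebius : topologicalType :=
  quotient_topology {eq_quot moebius_equiv}.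

(* The expression of a map on the Moebius strip in the coordinates (s, t). The
   projection [moebius_pi] is a covering map whose local inverses are the
   charts of the smooth structure of the strip, so local differential notions
   (smooth, immersion, metric, curvature) are read on [in_coord f]. *)
Definition moebius_pi (p : 'rV[R]_2) : moebius :=
  \pi_{eq_quot moebius_equiv} p.

Definition in_coord {Y : Type} (f : moebius -> Y) : 'rV[R]_2 -> Y :=
  fun p => f (moebius_pi p).

Definition smooth_embedding {m : nat} (f : moebius -> 'rV[R]_m) : Prop :=
  [/\ smooth (in_coord f), immersion (in_coord f) & topological_embedding f].

End Moebius.

(* Main.v *)
Require Import Defs.
From HB Require Import structures.
From mathcomp Require Import all_boot all_order all_algebra.
From mathcomp Require Import all_classical all_reals all_analysis.
From mathcomp Require Import ring lra.
Import Order.TTheory GRing.Theory Num.Theory.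
Import numFieldNormedType.Exports.
Local Open Scope classical_set_scope.
Local Open Scope ring_scope.

(** The strip lies over a teardrop curve in the base of the Hopf fibration.

    Write S^3 as the unit sphere of C^2. A curve W(v) in the affine chart C of
    CP^1 has as preimage under the Hopf map the surface
    exp(iu) (1, W(v)) / |(1, W(v))|, and this surface is flat whatever the
    curve: its metric is (du + A dv)^2 + (q dv)^2 with A and q depending on v
    only, so both forms are closed and are the differentials of Euclidean
    coordinates ([hopf_map_metric], [hopf_map_flat]).

    The preimage of an embedded curve is orientable, so W cannot be embedded.
    It is taken to be a teardrop, W(v) = v^2 + i loop v, where the odd function
    loop vanishes exactly at 0 and outside ]-1, 1[: for |v| < 1 the curve runs
    once around a closed loop, and for |v| >= 1 its two branches v and -v run
    along one and the same half-line, the stick. The core of the strip, at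
    v = 3 cos (pi s) and u = 2 pi s, goes around the loop, reaches the stick,
    makes a U-turn there (tangentially to the Hopf fiber) and enters the loop
    again, in the direction in which it first did. After one period it is back
    at its starting point, while v has become -v: the orientation (u, v) has
    been reversed. The strip is obtained by adding to v a bounded odd function
    of the transverse coordinate t, so that (s, t) |-> (s + 1, -t) exactly
    changes the sign of v.

    For the teardrop to be traversed in the same direction each time, loop v
    must be multiplied by the sign of sin (pi s). That sign jumps only where
    |v| >= 1, hence where loop vanishes, and it is replaced by a smooth
    function equal to 1 or -1 wherever |v| < 1. No analytic choice of loop is
    possible, which is where the function exp(-1/x) comes in.

    The strip is embedded because s modulo 1, then v^2 and loop v up to a known
    sign, can be read off continuously from a point of the image. They determine
    v: where v and -v lie on the stick, they are at distance at least 2, more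
    than the width of the strip ([image_filter_cvg]). *)

Set Implicit Arguments.
Unset Strict Implicit.
Unset Printing Implicit Defensive.

(** * Elementary functions of several variables *)

Section Elementary.
Context {R : realType} {n : nat}.
Implicit Types (f g : 'rV[R]_n -> R) (p : 'rV[R]_n).

(** A class of functions for which differentiation is a syntactic operation: it
    is closed under partial derivatives, so all its members are smooth, and the
    symmetry of second derivatives propagates through its constructors. In
    [elementary_comp] the outer function comes with the whole sequence [G] of
    its successive derivatives, valid on a set [D]; shifting the sequence is
    what keeps the class closed under differentiation. *)
Inductive elementary : ('rV[R]_n -> R) -> Prop :=
| elementary_cst c : elementary (fun=> c)
| elementary_coord i : elementary (fun p => p 0 i)
| elementaryD f g : elementary f -> elementary g ->
    elementary (fun p => f p + g p)
| elementaryM f g : elementary f -> elementary g ->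
    elementary (fun p => f p * g p)
| elementary_comp (D : set R) (G : nat -> R -> R) f :
    (forall k x, D x -> is_derive x 1 (G k) (G k.+1 x)) ->
    (forall p, D (f p)) -> elementary f -> elementary (fun p => G 0%N (f p)).

(** The chain rule along a line: a directional derivative is the derivative at
    0 of the restriction to a line, to which the one-variable rule applies. *)
Lemma is_derive_comp_line (G : R -> R) (f : 'rV[R]_n -> R) p v (dG df : R) :
  is_derive (f p) 1 G dG -> is_derive p v f df ->
  is_derive p v (fun q => G (f q)) (dG * df).
Proof.
move=> GdG fdf.
have f1 : is_derive (0 : R) 1 (fun h : R => f (h *: v + p)) df.
  have [fv <-] := fdf; split; first exact: (derivable1P f p v).1.
  rewrite /derive; set g1 := fun h => h^-1 *: _; set g2 := fun h => h^-1 *: _.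
  suff -> : g1 = g2 by []; apply/funext => h; rewrite /g1 /g2 /=.
  by rewrite scale0r add0r addr0 [h *: 1]mulr1.
have GdG0 : is_derive (f (0 *: v + p)) 1 G dG by rewrite scale0r add0r.
have [c1 c2] := @is_derive1_comp R G (fun h : R => f (h *: v + p)) 0 _ _ GdG0 f1.
split; first exact: (derivable1P _ p v).2.
rewrite -c2 /derive; set g1 := fun h => h^-1 *: _; set g2 := fun h => h^-1 *: _.
suff -> : g1 = g2 by []; apply/funext => h; rewrite /g1 /g2 /=.
by rewrite scale0r add0r addr0 [h *: 1]mulr1.
Qed.

Lemma is_derive_coord p (v : 'rV[R]_n) i :
  is_derive p v (fun q : 'rV[R]_n => q 0 i) (v 0 i).
Proof.
have lin : (fun h : R => h^-1 *: ((h *: v + p) 0 i - p 0 i)) @ 0^' --> v 0 i.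
  apply: (cvg_trans (G := cst (v 0 i) @ 0^')); last exact: cvg_cst.
  apply: near_eq_cvg; near=> h.
  rewrite !mxE addrK [_ *: _]mulrA mulVf ?mul1r //=.
  by near: h; exact: nbhs_dnbhs_neq.
apply: DeriveDef; first by apply/cvg_ex; exists (v 0 i).
exact/cvg_lim.
Unshelve. all: by end_near. Qed.

Lemma elementary_derivable f : elementary f ->
  forall p v, derivable f p v.
Proof.
elim=> {f} [c|i|f g _ df _ dg|f g _ df _ dg|D G f GD fD _ df] p v.
- exact: derivable_cst.
- exact: (@ex_derive _ _ _ _ _ _ _ (is_derive_coord p v i)).
- exact: (@derivableD _ _ _ f g).
- exact: (@derivableM _ _ f g).
- have [//] := is_derive_comp_line (GD 0%N _ (fD p)) (derivableP (df p v)).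
Qed.

Lemma elementary_continuous f : elementary f -> continuous f.
Proof.
elim=> {f} [c|i|f g _ cf _ cg|f g _ cf _ cg|D G f GD fD _ cf] p.
- exact: cst_continuous.
- exact: coord_continuous.
- by apply: continuousD; [exact: cf|exact: cg].
- by apply: continuousM; [exact: cf|exact: cg].
- apply: (continuous_comp (g := G 0%N)); first exact: cf.
  apply/differentiable_continuous/derivable1_diffP.
  by have [] := GD 0%N _ (fD p).
Qed.

Lemma partial_cst (i : 'I_n) (c : R) : partial i (fun=> c) = fun=> 0.
Proof. by apply/funext => p; exact: derive_cst. Qed.

Lemma partial_coord (i j : 'I_n) :
  partial i (fun p : 'rV[R]_n => p 0 j) = fun=> (j == i)%:R.
Proof.
apply/funext => p; rewrite /partial.
by rewrite (derive_val (is_derive := is_derive_coord p _ j)) mxE eqxx.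
Qed.

Lemma partialD i f g : elementary f -> elementary g ->
  partial i (fun p => f p + g p) = fun p => partial i f p + partial i g p.
Proof.
move=> ef eg; apply/funext => p.
by apply: (@deriveD _ _ _ f g); exact: elementary_derivable.
Qed.

Lemma partialM i f g : elementary f -> elementary g ->
  partial i (fun p => f p * g p) =
  fun p => f p * partial i g p + g p * partial i f p.
Proof.
move=> ef eg; apply/funext => p.
by apply: (@deriveM _ _ f g); exact: elementary_derivable.
Qed.

Lemma partial_comp i (G : R -> R) (dG : 'rV[R]_n -> R) f : elementary f ->
  (forall p, is_derive (f p) 1 G (dG p)) ->
  partial i (fun p => G (f p)) = fun p => dG p * partial i f p.
Proof.
move=> ef GdG; apply/funext => p.
have fP := derivableP (@elementary_derivable f ef p (delta_mx 0 i)).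
by have [] := is_derive_comp_line (GdG p) fP.
Qed.

Lemma elementary_partial i f : elementary f -> elementary (partial i f).
Proof.
elim=> {f} [c|j|f g ef df eg dg|f g ef df eg dg|D G f GD fD ef df].
- by rewrite partial_cst; exact: elementary_cst.
- by rewrite partial_coord; exact: elementary_cst.
- by rewrite partialD //; exact: elementaryD.
- by rewrite partialM //; apply: elementaryD; exact: elementaryM.
- have GD1 p : is_derive (f p) 1 (G 0%N) (G 1%N (f p)) by exact: GD.
  rewrite (partial_comp i ef GD1).
  apply: elementaryM => //.
  by apply: (@elementary_comp D (fun k => G k.+1)) => // k; exact: GD.
Qed.

(** Structural induction suffices here: the Leibniz and chain rules give
    expressions that are visibly symmetric in [i] and [j], so the mean value
    argument of Schwarz is avoided. *)
Lemma partialC i j f : elementary f ->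
  partial i (partial j f) = partial j (partial i f).
Proof.
have eP k h : elementary h -> elementary (partial k h).
  exact: elementary_partial.
elim=> {f} [c|k|f g ef sf eg sg|f g ef sf eg sg|D G f GD fD ef sf].
- by rewrite !partial_cst.
- by rewrite !partial_coord !partial_cst.
- have [fi fj gi gj] : [/\ elementary (partial i f), elementary (partial j f),
    elementary (partial i g) & elementary (partial j g)] by split; auto.
  rewrite (partialD i ef eg) (partialD j ef eg).
  by rewrite (partialD i fj gj) (partialD j fi gi) sf sg.
- have [fi fj gi gj] : [/\ elementary (partial i f), elementary (partial j f),
    elementary (partial i g) & elementary (partial j g)] by split; auto.
  rewrite (partialM i ef eg) (partialM j ef eg).
  rewrite (partialD i (elementaryM ef gj) (elementaryM eg fj)).
  rewrite (partialD j (elementaryM ef gi) (elementaryM eg fi)).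
  rewrite (partialM i ef gj) (partialM i eg fj) (partialM j ef gi).
  rewrite (partialM j eg fi) sf sg; apply/funext => p; ring.
- have GD1 k p : is_derive (f p) 1 (G k) (G k.+1 (f p)) by exact: GD.
  have eG1 : elementary (fun p => G 1%N (f p)).
    by apply: (@elementary_comp D (fun k => G k.+1)) => // k; exact: GD.
  rewrite (partial_comp i ef (GD1 0%N)) (partial_comp j ef (GD1 0%N)).
  rewrite (partialM i eG1 (eP j f ef)) (partialM j eG1 (eP i f ef)).
  rewrite (partial_comp i ef (GD1 1%N)) (partial_comp j ef (GD1 1%N)) sf.
  apply/funext => p; ring.
Qed.

End Elementary.

(** * Metrics with a closed orthonormal coframe *)

Section ElementarySum.
Context {R : realType} {n : nat}.

Lemma elementary_sum_partial (I : finType) (F : I -> 'rV[R]_n -> R) :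
  (forall a, elementary (F a)) ->
  elementary (fun p => \sum_a F a p) /\
  forall i, partial i (fun p => \sum_a F a p) =
            fun p => \sum_a partial i (F a) p.
Proof.
move=> eF; elim: (index_enum I) => [|a r [IHe IHp]].
  have -> : (fun p : 'rV[R]_n => \sum_(a <- [::]) F a p) = fun=> 0.
    by apply/funext => p; rewrite big_nil.
  split; first exact: elementary_cst.
  by move=> i; apply/funext => p; rewrite partial_cst big_nil.
have -> : (fun p : 'rV[R]_n => \sum_(a <- a :: r) F a p) =
          fun p => F a p + \sum_(a <- r) F a p.
  by apply/funext => p; rewrite big_cons.
split; first exact: elementaryD.
move=> i; rewrite (partialD i (eF a) IHe) IHp.
by apply/funext => p; rewrite big_cons.
Qed.

Lemma partial_sumM (I : finType) (F G : I -> 'rV[R]_n -> R) i :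
  (forall a, elementary (F a)) -> (forall a, elementary (G a)) ->
  partial i (fun p => \sum_a F a p * G a p) =
  fun p => \sum_a (F a p * partial i (G a) p + partial i (F a) p * G a p).
Proof.
move=> eF eG.
have [_ ->] := elementary_sum_partial (fun a => elementaryM (eF a) (eG a)).
apply/funext => p; apply: eq_bigr => a _.
by rewrite (partialM i (eF a) (eG a)) [X in _ + X]mulrC.
Qed.

End ElementarySum.

(** A metric [g = J J^T] whose coframe forms [J . a] are closed is flat, since
    these forms are locally differentials of Euclidean coordinates. The
    coordinates are not constructed: with [D_i] the derivative of [J] along
    the i-th coordinate and [K] the inverse of [J], the Christoffel symbols
    form the matrices [D_i K], and the curvature of such a connection vanishes
    because [D_i] is itself a derivative. *)
Section Flat.
Context {R : realType} {n : nat}.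
Variables (g : 'rV[R]_n -> 'M[R]_n) (J K : 'I_n -> 'I_n -> 'rV[R]_n -> R).
Hypothesis eJ : forall i a, elementary (J i a).
Hypothesis eK : forall a i, elementary (K a i).
Hypothesis closedJ : forall i j a, partial i (J j a) = partial j (J i a).
Hypothesis gE : forall p i j, g p i j = \sum_a J i a p * J j a p.

Let Jm p : 'M[R]_n := \matrix_(i, a) J i a p.
Let Km p : 'M[R]_n := \matrix_(a, i) K a i p.
Let DJ i p : 'M[R]_n := \matrix_(j, a) partial i (J j a) p.
Let DK i p : 'M[R]_n := \matrix_(a, j) partial i (K a j) p.

Hypothesis JK : forall p, Jm p *m Km p = 1%:M.

Let KJ p : Km p *m Jm p = 1%:M. Proof. exact: mulmx1C. Qed.

Let gm p : g p = Jm p *m (Jm p)^T.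
Proof.
by apply/matrixP => i j; rewrite gE !mxE; apply: eq_bigr => a _; rewrite !mxE.
Qed.

Let invg p : invmx (g p) = (Km p)^T *m Km p.
Proof.
have gK : g p *m ((Km p)^T *m Km p) = 1%:M.
  rewrite gm !mulmxA -(mulmxA (Jm p)) -trmx_mul KJ trmx1 mulmx1 JK //.
have [gu _] := mulmx1_unit gK.
by rewrite -[RHS](mulKmx gu) gK mulmx1.
Qed.

(** Closedness of the coframe symmetrizes the derivatives of J, and four of the
   six terms in the first-kind symbol cancel. *)
Let christoffelE k i j : christoffel g k i j = fun p => (DJ i p *m Km p) j k.
Proof.
apply/funext => p; rewrite /christoffel.
have dg i' j' l' : partial i' (fun q => g q j' l') p =
    \sum_a (J j' a p * partial i' (J l' a) p + partial i' (J j' a) p * J l' a p).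
  rewrite -[RHS](congr1 (fun f => f p) (partial_sumM i' (eJ j') (eJ l'))).
  by congr partial; apply/funext => q; exact: gE.
have -> : \sum_(l < n) invmx (g p) k l *
    (partial i (fun q => g q j l) p + partial j (fun q => g q i l) p
     - partial l (fun q => g q i j) p) =
    2 * (invmx (g p) *m (DJ i p *m (Jm p)^T)^T) k j.
  rewrite mxE mulr_sumr; apply: eq_bigr => l _.
  rewrite mulrCA; congr (_ * _).
  rewrite !dg !mxE -big_split -sumrB mulr_sumr; apply: eq_bigr => a _ /=.
  rewrite !mxE (closedJ l i) (closedJ l j) (closedJ j i); ring.
rewrite mulrA mulVf ?pnatr_eq0// mul1r invg.
rewrite trmx_mul trmxK -mulmxA (mulmxA (Km p)) KJ mul1mx -trmx_mul.
by rewrite mxE.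
Qed.

(** The derivative of an inverse matrix, from differentiating K J = 1. *)
Let DKE i p : DK i p = - (Km p *m DJ i p *m Km p).
Proof.
have H : Km p *m DJ i p + DK i p *m Jm p = 0.
  apply/matrixP => b a; rewrite !mxE -big_split /=.
  transitivity (partial i (fun q => \sum_m K b m q * J m a q) p).
    rewrite (partial_sumM i (eK b) (fun m => eJ m a)).
    by apply: eq_bigr => m _; rewrite !mxE.
  have -> : (fun q => \sum_m K b m q * J m a q) = fun=> (b == a)%:R.
    apply/funext => q; have /matrixP/(_ b a) := KJ q; rewrite !mxE => <-.
    by apply: eq_bigr => m _; rewrite !mxE.
  by rewrite partial_cst.
have := congr1 (mulmx^~ (Km p)) H.
rewrite mul0mx mulmxDl -(mulmxA (DK i p)) JK mulmx1 addrC => /eqP.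
by rewrite addr_eq0 => /eqP.
Qed.

Lemma flat_of_closed_coframe : flat_metric g.
Proof.
move=> l i j k p; rewrite /riemann !christoffelE.
have dGam i' j' : partial i' (fun q => (DJ j' q *m Km q) k l) p =
    \sum_a (partial j' (J k a) p * partial i' (K a l) p
            + partial i' (partial j' (J k a)) p * K a l p).
  rewrite -[RHS](congr1 (fun f => f p) (partial_sumM i'
     (fun a => elementary_partial j' (eJ k a)) (fun a => eK a l))).
  congr partial; apply/funext => q; rewrite mxE.
  by apply: eq_bigr => a _; rewrite !mxE.
pose S i' j' := \sum_a partial i' (partial j' (J k a)) p * K a l p.
have split1 i' j' : partial i' (fun q => (DJ j' q *m Km q) k l) p =
    - (DJ j' p *m Km p *m (DJ i' p *m Km p)) k l + S i' j'.
  rewrite dGam big_split /=; congr (_ + _).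
  transitivity ((DJ j' p *m DK i' p) k l); last first.
    by rewrite DKE mulmxN mxE !mulmxA.
  by rewrite mxE; apply: eq_bigr => a _; rewrite !mxE.
(* By DKE the derivative of D_j K produces a product of two Christoffel
   matrices, which cancels the quadratic part of the curvature; the terms S
   that remain are the second derivatives of J. *)
have SC : S j i = S i j.
  by apply: eq_bigr => a _; rewrite (partialC j i (eJ k a)).
pose T i' j' := (DJ j' p *m Km p *m (DJ i' p *m Km p)) k l.
have GG : \sum_(a < n) (christoffel g l i a p * christoffel g a j k p
                  - christoffel g l j a p * christoffel g a i k p) =
  T i j - T j i.
  rewrite /T [X in _ = X - _]mxE [X in _ = _ - X]mxE -sumrB.
  by apply: eq_bigr => a _; rewrite !christoffelE; congr (_ - _); rewrite mulrC.
have cancelT (x1 x2 x3 t1 t2 s : R) :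
    x1 = - t1 + s -> x2 = - t2 + s -> x3 = t1 - t2 -> x1 - x2 + x3 = 0.
  by move=> -> -> ->; ring.
apply: cancelT GG; first exact: split1.
by rewrite -SC; exact: split1.
Qed.

End Flat.

(** * The flat function *)

Section FlatFunction.
Context {R : realType}.
Implicit Types (p : {poly R}) (x : R).

(** The functions P(1/x) exp(-1/x), extended by 0 to x <= 0. They form a family
    stable under differentiation that contains the flat function (P = 1). *)
Definition flatpoly p x : R :=
  if 0 < x then p.[x^-1] * expR (- x^-1) else 0.

(** One term of the exponential series already bounds y^m / m!. *)
Lemma exp_dominates_monomial (m : nat) (y : R) : 0 < y ->
  y ^+ m * expR (- y) <= m`!%:R.
Proof.
move=> y0; rewrite expRN ler_pdivrMr ?expR_gt0 //.
case: m => [|m]; first by rewrite expr0 fact0 mul1r -expR0 ler_expR ltW.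
have := expR_ge1Dxn m (ltW y0) => le1.
rewrite mulrC -ler_pdivrMr ?ltr0n ?fact_gt0 //.
by apply: le_trans le1; rewrite lerDr.
Qed.

(** With y = 1/x, a monomial of P contributes
    y^i exp(-y) = x (y^(i+1) exp(-y)), and the last factor is bounded. *)
Lemma flatpoly_lipschitz0 p :
  exists C, 0 <= C /\ forall x, `|flatpoly p x| <= C * `|x|.
Proof.
exists (\sum_(i < size p) `|p`_i| * i.+1`!%:R); split.
  by apply: sumr_ge0 => i _; rewrite mulr_ge0.
move=> x; rewrite /flatpoly; case: ifPn => [x0|_]; last first.
  by rewrite normr0 mulr_ge0 // sumr_ge0 // => i _; rewrite mulr_ge0.
rewrite horner_coef mulr_suml (le_trans (ler_norm_sum _ _ _)) // mulr_suml.
apply: ler_sum => i _.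
rewrite (gtr0_norm x0) -!mulrA normrM ler_wpM2l //.
have xV0 : 0 < x^-1 by rewrite invr_gt0.
rewrite ger0_norm; last by rewrite mulr_ge0 ?exprn_ge0 ?expR_ge0 // ltW.
have := exp_dominates_monomial i.+1 xV0.
rewrite exprS -mulrA -ler_pdivlMl ?invr_gt0 // invrK mulrC //.
by rewrite [X in _ <= X]mulrC mulrC.
Qed.

(** At 0, the difference quotient of [flatpoly p] is [flatpoly (p * 'X)], which
    tends to 0 by the Lipschitz bound. *)
Lemma is_derive_flatpoly p x :
  is_derive x 1 (flatpoly p) (flatpoly ('X^2 * (p - p^`())) x).
Proof.
have [x0|x0|->] := ltgtP x 0.
- rewrite [X in is_derive _ _ _ X]/flatpoly ltNge (ltW x0) /=.
  apply: (@near_eq_is_derive _ _ _ (cst 0)).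
  near=> y; rewrite /flatpoly ifF //; apply/negbTE; rewrite -leNgt ltW //.
  by near: y; exact: lt_nbhsl.
- rewrite [X in is_derive _ _ _ X]/flatpoly x0.
  apply: (@near_eq_is_derive R R^o R^o (fun y : R => p.[y^-1] * expR (- y^-1))).
    near=> y; rewrite /flatpoly ifT //; near: y; exact: lt_nbhsr.
  have xn0 : x != 0 by rewrite gt_eqF.
  have dV : is_derive x 1 (fun y : R => y^-1) (- x ^- 2).
    apply: is_derive_eq.
      by apply: (@is_deriveV _ (fun y => y) x 1 1) => //; exact: is_derive_id.
    by rewrite [_ *: _]mulr1.
  have dE : is_derive x 1 (fun y : R => expR (- y^-1)) (expR (- x^-1) * x ^- 2).
    have dN := @is_deriveN _ _ _ (fun y : R => y^-1) x 1 _ dV.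
    by have := @is_derive1_comp R expR _ x _ _ _ dN; rewrite opprK; apply.
  have dP : is_derive x 1 (fun y : R => p.[y^-1]) (p^`().[x^-1] * (- x ^- 2)).
    by have := @is_derive1_comp R (horner p) _ x _ _ _ dV; apply.
  have [dM dME] := @is_deriveM R _ _ _ x 1 _ _ dP dE.
  split; first exact: dM.
  rewrite [LHS]dME; rewrite !hornerE /= /GRing.scale /= exprVn; ring.
- rewrite [X in is_derive _ _ _ X]/flatpoly ltxx.
  have [C [C0 HC]] := flatpoly_lipschitz0 (p * 'X).
  have lim0 : (fun h : R => h^-1 *: (flatpoly p (h *: 1 + 0) - flatpoly p 0))
      @ 0^' --> (0 : R).
    apply/cvgrPdist_le => /= e e0; near=> h.
    have h0 : h != 0 by near: h; exact: nbhs_dnbhs_neq.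
    rewrite sub0r normrN {2}/flatpoly ltxx subr0 addr0 [h *: 1]mulr1.
    have -> : h^-1 *: flatpoly p h = flatpoly (p * 'X) h.
      rewrite /flatpoly; case: ifP; last by rewrite scaler0.
      by rewrite !hornerE /= /GRing.scale /= => _; ring.
    apply: le_trans (HC h) _.
    have : `|h| <= e / (C + 1).
      near: h; apply: dnbhs0_le; rewrite divr_gt0 //; lra.
    rewrite ler_pdivlMr; last lra.
    have := normr_ge0 h; nra.
  split; first by apply/cvg_ex; exists 0.
  exact/cvg_lim.
Unshelve. all: by end_near. Qed.

Lemma flatpoly_le0 p x : x <= 0 -> flatpoly p x = 0.
Proof. by rewrite /flatpoly leNgt => /negbTE ->. Qed.

Definition flat_exp : R -> R := flatpoly 1.

(** The derivative of [flat_exp]. *)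
Definition flat_exp' : R -> R := flatpoly ('X^2 * (1 - 1^`())).

Lemma flat_exp_gt0 x : 0 < x -> 0 < flat_exp x.
Proof. by move=> x0; rewrite /flat_exp /flatpoly x0 hornerE mul1r expR_gt0. Qed.

End FlatFunction.

(** * Examples of elementary functions *)

Section ElementaryFunctions.
Context {R : realType} {n : nat}.
Implicit Types f g : 'rV[R]_n -> R.

Lemma elementaryN f : elementary f -> elementary (fun p => - f p).
Proof.
move=> ef; have -> : (fun p => - f p) = fun p => (-1) * f p.
  by apply/funext => p; rewrite mulN1r.
by apply: elementaryM => //; exact: elementary_cst.
Qed.

Lemma elementaryB f g : elementary f -> elementary g ->
  elementary (fun p => f p - g p).
Proof. by move=> ef eg; apply: elementaryD => //; exact: elementaryN. Qed.

Lemma partialN i f : elementary f ->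
  partial i (fun p => - f p) = fun p => - partial i f p.
Proof.
move=> ef; have -> : (fun p => - f p) = fun p => (-1) * f p.
  by apply/funext => p; rewrite mulN1r.
rewrite (partialM i (elementary_cst (-1)) ef) partial_cst.
by apply/funext => p; rewrite mulr0 addr0 mulN1r.
Qed.

Lemma partialB i f g : elementary f -> elementary g ->
  partial i (fun p => f p - g p) = fun p => partial i f p - partial i g p.
Proof. by move=> ef eg; rewrite (partialD i ef (elementaryN eg)) partialN. Qed.

Lemma elementary_sin f : elementary f -> elementary (fun p => sin (f p)).
Proof.
move=> ef; pose G (k : nat) (x : R) := sin (x + k%:R * (pi / 2)).
have -> : (fun p => sin (f p)) = fun p => G 0%N (f p).
  by apply/funext => p; rewrite /G mul0r addr0.
apply: (@elementary_comp _ _ setT G) => // k x _.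
have dx : is_derive x (1 : R) (fun y : R => y + k%:R * (pi / 2)) 1.
  split; first exact: (@derivableD _ _ _ id (cst _)).
  by rewrite (@deriveD _ _ _ id (cst _)) // derive_id derive_cst addr0.
have [d1 d2] := @is_derive1_comp R sin _ x _ _ (is_derive_sin _) dx.
split; first exact: d1.
by rewrite [LHS]d2 mulr1 /G -sinDpihalf -[k.+1%:R]natr1 (mulrDl k%:R 1) mul1r addrA.
Qed.

Lemma elementary_cos f : elementary f -> elementary (fun p => cos (f p)).
Proof.
move=> ef; have -> : (fun p => cos (f p)) = fun p => sin (f p + pi / 2).
  by apply/funext => p; rewrite sinDpihalf.
by apply: elementary_sin; apply: elementaryD => //; exact: elementary_cst.
Qed.

Lemma elementary_expR f : elementary f -> elementary (fun p => expR (f p)).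
Proof.
by move=> ef; apply: (@elementary_comp _ _ setT (fun=> expR)) => // k x _;
  exact: is_derive_expR.
Qed.

Lemma elementary_powR a f : (forall p, 0 < f p) -> elementary f ->
  elementary (fun p => f p `^ a).
Proof.
move=> f0 ef.
pose G (k : nat) (x : R) := \prod_(j < k) (a - j%:R) * x `^ (a - k%:R).
have -> : (fun p => f p `^ a) = fun p => G 0%N (f p).
  by apply/funext => p; rewrite /G big_ord0 mul1r subr0.
apply: (@elementary_comp _ _ [set x | 0 < x] G) => // k x /= x0.
have dp := is_derive1_powR (a - k%:R) x0.
have [d1 d2] := @is_deriveZ _ _ _ _ (\prod_(j < k) (a - j%:R)) x 1 _ dp.
split; first exact: d1.
rewrite [LHS]d2 /G big_ord_recr /= -mulrA; congr (_ * (_ * powR _ _)).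
by rewrite -[k.+1%:R]natr1 opprD addrA.
Qed.

Lemma elementaryV f : (forall p, f p != 0) -> elementary f ->
  elementary (fun p => (f p)^-1).
Proof.
move=> f0 ef.
have ff0 p : 0 < f p * f p by rewrite -expr2 exprn_even_gt0 //= f0.
(* The real power requires a positive base, whence the square. *)
have -> : (fun p => (f p)^-1) = fun p => f p * (f p * f p) `^ (-1).
  apply/funext => p; rewrite powR_inv1 ?ltW//.
  by rewrite invfM mulrA mulfV ?mul1r.
by apply: elementaryM => //; apply: elementary_powR => //; exact: elementaryM.
Qed.

Lemma elementary_sqrt f : (forall p, 0 < f p) -> elementary f ->
  elementary (fun p => Num.sqrt (f p)).
Proof.
move=> f0 ef.
have -> : (fun p => Num.sqrt (f p)) = fun p => f p `^ 2^-1.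
  by apply/funext => p; rewrite powR12_sqrt // ltW.
exact: elementary_powR.
Qed.

Lemma elementary_flatpoly (P : {poly R}) f : elementary f ->
  elementary (fun p => flatpoly P (f p)).
Proof.
move=> ef; pose G k := flatpoly (iter k (fun P => 'X^2 * (P - P^`())) P).
by apply: (@elementary_comp _ _ setT G) => // k x _; exact: is_derive_flatpoly.
Qed.

End ElementaryFunctions.

(** * Hopf cylinders *)

Section VectorValued.
Context {R : realType} {n m : nat}.
Implicit Type F : 'rV[R]_n -> 'rV[R]_m.

Lemma cvg_row (T : Type) (G : set_system T) {FG : Filter G}
    (F : T -> 'rV[R]_m) (l : 'rV[R]_m) :
  (forall j, F p 0 j @[p --> G] --> l 0 j) -> F @ G --> l.
Proof.
move=> Fl; apply/cvgrPdist_le => /= e e0; near=> q.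
rewrite [leLHS]/Num.Def.normr/= mx_normrE (bigmax_le _ (ltW e0)) //= => -[i j] _.
rewrite !mxE /= (ord1 i); move: j; near: q; apply: filter_forall => j.
by have /cvgrPdist_le/(_ _ e0) := Fl j.
Unshelve. all: by end_near. Qed.

Lemma partial_row F i : (forall j, elementary (fun p => F p 0 j)) ->
  (forall p, derivable F p (delta_mx 0 i)) /\
  partial i F = fun p => \row_j partial i (fun q => F q 0 j) p.
Proof.
move=> eF.
have dF p : derivable F p (delta_mx 0 i).
  by apply/derivable_mxP => a b; rewrite (ord1 a); exact: elementary_derivable.
split=> //; apply/funext => p; rewrite /partial derive_mx //.
by apply/rowP => j; rewrite !mxE.
Qed.

Lemma smooth_row F : (forall j, elementary (fun p => F p 0 j)) -> smooth F.
Proof.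
move=> eF k; elim: k F eF => [|k IHk] F eF /=; split=> //.
- by move=> p; apply: (@cvg_row _ (nbhs p)) => j; exact: elementary_continuous.
- by move=> p; apply: (@cvg_row _ (nbhs p)) => j; exact: elementary_continuous.
- move=> i; have [dF pF] := partial_row i eF; split=> //.
  apply: IHk => j; rewrite pF.
  have -> : (fun p => (\row_j0 partial i (fun q => F q 0 j0) p) 0 j) =
            partial i (fun q => F q 0 j) by apply/funext => p; rewrite mxE.
  exact: elementary_partial.
Qed.

Lemma induced_metricE F p (M := \matrix_(i < n) partial i F p) :
  induced_metric F p = M *m M^T.
Proof.
apply/matrixP => i j; rewrite !mxE; apply: eq_bigr => k _.
by rewrite !mxE.
Qed.

(** The metric is the Gram matrix of the rows of the differential. *)
Lemma immersion_of_unit_metric F :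
  (forall p, induced_metric F p \in unitmx) -> immersion F.
Proof.
move=> gu p; have := gu p; rewrite induced_metricE -row_free_unit /row_free.
move=> /eqP rk; rewrite eqn_leq rank_leq_row /= -{1}rk; exact: mxrankM_maxl.
Qed.

End VectorValued.

Lemma dot_row4 (R : realType) (a0 a1 a2 a3 b0 b1 b2 b3 : R) :
  dot (\row_(l < 4) [:: a0; a1; a2; a3]`_l) (\row_(l < 4) [:: b0; b1; b2; b3]`_l)
  = a0 * b0 + a1 * b1 + a2 * b2 + a3 * b3.
Proof. by rewrite /dot !big_ord_recl big_ord0 !mxE /= addr0 !addrA. Qed.

(** The preimage in S^3 of a curve W = y + iz of the chart C of CP^1, with
    fiber coordinate u. The curve parameter v and the angle u are functions on
    the plane; y and z are functions of v to first order, with derivatives y'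
    and z' along v. As the sign of the ordinate of the teardrop also depends on
    s, y' and z' are not assumed to be globally functions of v, only to have
    differentials proportional to dv. *)
Section HopfCylinder.
Context {R : realType}.
Variables u v y z y' z' : 'rV[R]_2 -> R.
Hypotheses (eu : elementary u) (ev : elementary v).
Hypotheses (ey : elementary y) (ez : elementary z).
Hypotheses (ey' : elementary y') (ez' : elementary z').

Definition d_proportional (f : 'rV[R]_2 -> R) :=
  forall p, exists c, forall i, partial i f p = c * partial i v p.

Hypothesis dy : forall i p, partial i y p = y' p * partial i v p.
Hypothesis dz : forall i p, partial i z p = z' p * partial i v p.
Hypotheses (fy' : d_proportional y') (fz' : d_proportional z').
Hypothesis regular : forall p, 0 < y' p * y' p + z' p * z' p.

Let D p := partial 0 u p * partial 1 v p - partial 1 u p * partial 0 v p.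
Hypothesis D_neq0 : forall p, D p != 0.

Definition hopf_norm2 p := 1 + (y p * y p + z p * z p).

Definition hopf_scale p := hopf_norm2 p `^ (- 2^-1).

(** exp(iu) (1, y + iz) / |(1, y + iz)|, in real coordinates. *)
Definition hopf_map p : 'rV[R]_4 := \row_(j < 4)
  [:: hopf_scale p * cos (u p);
      hopf_scale p * sin (u p);
      hopf_scale p * (y p * cos (u p) - z p * sin (u p));
      hopf_scale p * (y p * sin (u p) + z p * cos (u p))]`_j.

Local Notation r := hopf_scale.

Let norm2_gt0 p : 0 < hopf_norm2 p.
Proof. by rewrite ltr_pwDl// addr_ge0// -expr2 sqr_ge0. Qed.

Let norm2_elementary : elementary hopf_norm2.
Proof.
apply: elementaryD; first exact: elementary_cst.
by apply: elementaryD; exact: elementaryM.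
Qed.

Let er : elementary r.
Proof. exact: elementary_powR. Qed.

Lemma hopf_scale_gt0 p : 0 < r p.
Proof. exact: powR_gt0. Qed.

Lemma hopf_scaleK p : r p * r p * hopf_norm2 p = 1.
Proof.
rewrite -powRD; last by rewrite (gt_eqF (norm2_gt0 p)) implybT.
have -> : - 2^-1 + - 2^-1 = -1 :> R by lra.
by rewrite powR_inv1 ?ltW// mulVf // gt_eqF.
Qed.

Lemma hopf_map_sphere p : sphere R 4 (hopf_map p).
Proof.
rewrite /sphere /= /hopf_map dot_row4.
have := hopf_scaleK p; have := cos2Dsin2 (u p); rewrite /hopf_norm2.
move: (cos _) (sin _) (r p) (y p) (z p) => c s w a b cs rN.
have {}cs : c ^+ 2 = 1 - s ^+ 2 by rewrite -cs addrK.
by rewrite -rN; ring: cs.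
Qed.

(** From differentiating r^2 (1 + y^2 + z^2) = 1. *)
Let partial_r i p : 2 * partial i r p =
  - (r p * r p * r p) *
    (2 * (y p * y' p + z p * z' p) * partial i v p).
Proof.
have dN : partial i hopf_norm2 p =
    2 * (y p * y' p + z p * z' p) * partial i v p.
  rewrite /hopf_norm2 (partialD i (elementary_cst 1)
    (elementaryD (elementaryM ey ey) (elementaryM ez ez))) partial_cst.
  rewrite (partialD i (elementaryM ey ey) (elementaryM ez ez)).
  rewrite (partialM i ey ey) (partialM i ez ez) dy dz; ring.
have : partial i (fun p => r p * r p * hopf_norm2 p) p = 0.
  have -> : (fun p => r p * r p * hopf_norm2 p) = fun=> 1.
    by apply/funext => q; exact: hopf_scaleK.
  by rewrite partial_cst.
rewrite (partialM i (elementaryM er er) norm2_elementary) (partialM i er er) dN.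
move: (hopf_scaleK p); move: (partial i r p) (partial i v p) (hopf_norm2 p).
move=> ri vi N rN drN.
have : r p * (r p * r p * (2 * (y p * y' p + z p * z' p) * vi)
              + N * (r p * ri + r p * ri)) = 0 by rewrite drN mulr0.
have -> : r p * (r p * r p * (2 * (y p * y' p + z p * z' p) * vi) +
    N * (r p * ri + r p * ri)) =
  r p * r p * r p * (2 * (y p * y' p + z p * z' p) * vi)
   + (r p * r p * N) * (2 * ri) by ring.
by rewrite rN mul1r mulNr => /eqP; rewrite addrC addr_eq0 => /eqP.
Qed.

(** The coefficient of dv in the connection form <iF, dF> of the Hopf fibration,
    where F is the map at u = 0. *)
Definition hopf_connection p := r p * r p * (y p * z' p - z p * y' p).

(** The speed of the curve for the Fubini-Study metric |dW|^2 / (1 + |W|^2)^2. *)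
Definition hopf_speed p :=
  r p * r p * Num.sqrt (y' p * y' p + z' p * z' p).

Definition hopf_coframe (i a : 'I_2) p :=
  if a == 0 then partial i u p + hopf_connection p * partial i v p
  else hopf_speed p * partial i v p.

Let ecs : elementary (fun p => cos (u p)) /\ elementary (fun p => sin (u p)).
Proof. by split; [exact: elementary_cos|exact: elementary_sin]. Qed.

Let partial_cos i : partial i (fun p => cos (u p)) =
  fun p => - sin (u p) * partial i u p.
Proof. by apply: (partial_comp i (dG := fun p => - sin (u p))). Qed.

Let partial_sin i : partial i (fun p => sin (u p)) =
  fun p => cos (u p) * partial i u p.
Proof. exact: partial_comp. Qed.

Lemma hopf_map_elementary j : elementary (fun p => hopf_map p 0 j).
Proof.
have [ec es] := ecs.
have -> : (fun p => hopf_map p 0 j) = fun p =>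
  [:: r p * cos (u p); r p * sin (u p);
      r p * (y p * cos (u p) - z p * sin (u p));
      r p * (y p * sin (u p) + z p * cos (u p))]`_j.
  by apply/funext => p; rewrite mxE.
case: j => -[|[|[|[|//]]]] /= _; apply: elementaryM => //.
- by apply: elementaryB; exact: elementaryM.
- by apply: elementaryD; exact: elementaryM.
Qed.

(** Pythagoras for the Hopf fibration: the component of the differential along
    the fiber is du + A dv, and the horizontal component has the length of its
    projection to CP^1. *)
Lemma hopf_map_metric p i j : induced_metric hopf_map p i j =
  \sum_a hopf_coframe i a p * hopf_coframe j a p.
Proof.
have [ec es] := ecs.
have dF k : partial k hopf_map p = \row_(l < 4)
  [:: partial k r p * cos (u p) - r p * (sin (u p) * partial k u p);
      partial k r p * sin (u p) + r p * (cos (u p) * partial k u p);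
      partial k r p * (y p * cos (u p) - z p * sin (u p))
      + r p * (y' p * partial k v p * cos (u p) - z' p * partial k v p * sin (u p)
               - (y p * sin (u p) + z p * cos (u p)) * partial k u p);
      partial k r p * (y p * sin (u p) + z p * cos (u p))
      + r p * (y' p * partial k v p * sin (u p) + z' p * partial k v p * cos (u p)
               + (y p * cos (u p) - z p * sin (u p)) * partial k u p)]`_l.
  have [_ ->] := partial_row k hopf_map_elementary.
  apply/rowP => l; rewrite !mxE.
  have -> : (fun p => hopf_map p 0 l) = fun p =>
    [:: r p * cos (u p); r p * sin (u p);
        r p * (y p * cos (u p) - z p * sin (u p));
        r p * (y p * sin (u p) + z p * cos (u p))]`_l.
    by apply/funext => q; rewrite mxE.
  case: l => -[|[|[|[|//]]]] /= _.
  - rewrite (partialM k er ec) partial_cos; ring.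
  - rewrite (partialM k er es) partial_sin; ring.
  - rewrite (partialM k er (elementaryB (elementaryM ey ec) (elementaryM ez es))).
    rewrite (partialB k (elementaryM ey ec) (elementaryM ez es)).
    rewrite (partialM k ey ec) (partialM k ez es) partial_cos partial_sin dy dz.
    ring.
  - rewrite (partialM k er (elementaryD (elementaryM ey es) (elementaryM ez ec))).
    rewrite (partialD k (elementaryM ey es) (elementaryM ez ec)).
    rewrite (partialM k ey es) (partialM k ez ec) partial_cos partial_sin dy dz.
    ring.
rewrite mxE (dF i) (dF j) dot_row4 !big_ord_recl big_ord0 /hopf_coframe /=.
rewrite /hopf_connection /hopf_speed.
have := sqr_sqrtr (ltW (regular p)); have := hopf_scaleK p.
have := cos2Dsin2 (u p); have := partial_r i p; have := partial_r j p.
rewrite /hopf_norm2.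
move: (Num.sqrt _) (partial i r p) (partial j r p) (cos _) (sin _) (r p).
move: (partial i u p) (partial j u p) (partial i v p) (partial j v p).
move: (y p) (z p) (y' p) (z' p) => a b a' b' ui uj vi vj q ri rj c s w.
move=> rjE riE cs rN qE.
have {}riE : ri = - (w * w * w) * ((a * a' + b * b') * vi) by lra.
have {}rjE : rj = - (w * w * w) * ((a * a' + b * b') * vj) by lra.
rewrite riE rjE !addr0.
have {}cs : c ^+ 2 = 1 - s ^+ 2 by rewrite -cs addrK.
(* The normalization, solved for one monomial so that it can be used as a
   rewriting rule. *)
have {}rN : w ^+ 2 * a ^+ 2 = 1 - w ^+ 2 - w ^+ 2 * b ^+ 2 by rewrite -rN; ring.
have {}qE : q ^+ 2 = a' ^+ 2 + b' ^+ 2 by rewrite qE !expr2.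
by ring: cs qE rN.
Qed.

Let d_proportionalD f g : elementary f -> elementary g ->
  d_proportional f -> d_proportional g -> d_proportional (fun p => f p + g p).
Proof.
move=> ef eg ff fg p; have [c cE] := ff p; have [d dE] := fg p.
by exists (c + d) => i; rewrite (partialD i ef eg) cE dE mulrDl.
Qed.

Let d_proportionalM f g : elementary f -> elementary g ->
  d_proportional f -> d_proportional g -> d_proportional (fun p => f p * g p).
Proof.
move=> ef eg ff fg p; have [c cE] := ff p; have [d dE] := fg p.
exists (f p * d + g p * c) => i.
by rewrite (partialM i ef eg) cE dE mulrDl !mulrA.
Qed.

Let fy : d_proportional y. Proof. by move=> p; exists (y' p). Qed.
Let fz : d_proportional z. Proof. by move=> p; exists (z' p). Qed.

Let fr : d_proportional r.
Proof.
move=> p; exists (- (r p * r p * r p) * (y p * y' p + z p * z' p)) => i.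
have := partial_r i p; lra.
Qed.

Let speed2_elementary : elementary (fun p => y' p * y' p + z' p * z' p).
Proof. by apply: elementaryD; exact: elementaryM. Qed.

Let connection_elementary : elementary hopf_connection.
Proof.
by apply: elementaryM; [exact: elementaryM|apply: elementaryB; exact: elementaryM].
Qed.

Let speed_elementary : elementary hopf_speed.
Proof. by apply: elementaryM; [exact: elementaryM|exact: elementary_sqrt]. Qed.

Let connection_d_proportional : d_proportional hopf_connection.
Proof.
apply: d_proportionalM; [exact: elementaryM| | exact: d_proportionalM|].
  by apply: elementaryB; exact: elementaryM.
have ezy' := elementaryM ez ey'.
have fzy' : d_proportional (fun p => - (z p * y' p)).
  move=> p; have [c cE] := d_proportionalM ez ey' fz fy' p.
  by exists (- c) => i; rewrite (partialN i ezy') cE mulNr.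
by apply: d_proportionalD => //;
  [exact: elementaryM|exact: elementaryN|exact: d_proportionalM].
Qed.

Let speed_d_proportional : d_proportional hopf_speed.
Proof.
have e1 := elementaryM ey' ey'; have e2 := elementaryM ez' ez'.
apply: d_proportionalM; [exact: elementaryM|exact: elementary_sqrt
  |exact: d_proportionalM|].
move=> p.
have [c cE] := d_proportionalD e1 e2 (d_proportionalM ey' ey' fy' fy')
  (d_proportionalM ez' ez' fz' fz') p.
pose q p := Num.sqrt (y' p * y' p + z' p * z' p).
have q0 : 0 < q p by rewrite sqrtr_gt0.
have eq : elementary q by exact: elementary_sqrt.
exists (c / (2 * q p)) => i; rewrite mulrAC -cE -/q.
have -> : (fun p => y' p * y' p + z' p * z' p) = fun p => q p * q p.
  by apply/funext => s; rewrite -[RHS]expr2 sqr_sqrtr // ltW.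
rewrite (partialM i eq eq); field; lra.
Qed.

(** The exterior derivative of f dv is the wedge product of df and dv. *)
Let closed_multiple f i j : elementary f -> d_proportional f ->
  partial i (fun p => f p * partial j v p) =
  partial j (fun p => f p * partial i v p).
Proof.
move=> ef ff; have ep k := elementary_partial k ev.
rewrite (partialM i ef (ep j)) (partialM j ef (ep i)) (partialC i j ev).
by apply/funext => p; have [c cE] := ff p; rewrite !cE; ring.
Qed.

Let coframe_elementary i a : elementary (hopf_coframe i a).
Proof.
have eui := elementary_partial i eu; have evi := elementary_partial i ev.
rewrite /hopf_coframe; case: (a == 0); last exact: elementaryM.
by apply: elementaryD => //; exact: elementaryM.
Qed.

Let coframe_closed i j a :
  partial i (hopf_coframe j a) = partial j (hopf_coframe i a).
Proof.
have eui k := elementary_partial k eu; have evi k := elementary_partial k ev.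
rewrite /hopf_coframe; case: (a == 0); last exact: closed_multiple.
rewrite (partialD i (eui j) (elementaryM connection_elementary (evi j))).
rewrite (partialD j (eui i) (elementaryM connection_elementary (evi i))).
by rewrite (partialC i j eu) (closed_multiple i j connection_elementary).
Qed.

Let speed_gt0 p : 0 < hopf_speed p.
Proof. by rewrite !mulr_gt0 ?hopf_scale_gt0 // sqrtr_gt0. Qed.

(** Cramer's rule: the determinant of the coframe is D times the speed. *)
Let frame (a i : 'I_2) p :=
  if a == 0 then
    if i == 0 then partial 1 v p * (D p)^-1 else - (partial 0 v p * (D p)^-1)
  else
    if i == 0 then - (hopf_coframe 1 0 p * (D p * hopf_speed p)^-1)
    else hopf_coframe 0 0 p * (D p * hopf_speed p)^-1.

Let frame_elementary a i : elementary (frame a i).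
Proof.
have eui k := elementary_partial k eu; have evi k := elementary_partial k ev.
have eD : elementary D by apply: elementaryB; exact: elementaryM.
have eDV : elementary (fun p => (D p)^-1) by exact: elementaryV.
have eDsV : elementary (fun p => (D p * hopf_speed p)^-1).
  apply: elementaryV; last exact: elementaryM.
  by move=> p; rewrite mulf_neq0 // gt_eqF.
rewrite /frame; case: (a == 0); case: (i == 0);
  do ?[apply: elementaryN]; exact: elementaryM.
Qed.

Let coframeK p : (\matrix_(i < 2, a < 2) hopf_coframe i a p) *m
  (\matrix_(a < 2, i < 2) frame a i p) = 1%:M.
Proof.
have Dn0 := D_neq0 p; have sn0 : hopf_speed p != 0 by rewrite gt_eqF.
have ord2 (i : 'I_2) : i = 0 \/ i = 1.
  by case: i => -[|[|//]] ?; [left|right]; apply/val_inj.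
apply/matrixP => i j; rewrite !mxE !big_ord_recl big_ord0 !mxE /frame.
have -> : lift ord0 ord0 = 1 :> 'I_2 by apply/val_inj.
move: Dn0 sn0; rewrite /hopf_coframe /D /=.
case: (ord2 i) => ->; case: (ord2 j) => -> /=;
  move: (hopf_speed p) (hopf_connection p) => q c;
  move: (partial 0 u p) (partial 1 u p) (partial 0 v p) (partial 1 v p);
  by move=> u0 u1 v0 v1 Dn0 sn0; field; rewrite ?sn0.
Qed.

(** Both coframe forms are closed: du is exact, and the coefficients of dv have
    differentials proportional to dv. *)
Lemma hopf_map_flat : flat_metric (induced_metric hopf_map).
Proof.
apply: (flat_of_closed_coframe (J := hopf_coframe) (K := frame)) => //.
by move=> p i j; exact: hopf_map_metric.
Qed.

Lemma hopf_map_smooth : smooth hopf_map.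
Proof. exact/smooth_row/hopf_map_elementary. Qed.

Lemma hopf_map_immersion : immersion hopf_map.
Proof.
apply: immersion_of_unit_metric => p.
have -> : induced_metric hopf_map p =
    (\matrix_(i < 2, a < 2) hopf_coframe i a p) *m
    (\matrix_(i < 2, a < 2) hopf_coframe i a p)^T.
  apply/matrixP => i j; rewrite hopf_map_metric !mxE.
  by apply: eq_bigr => a _; rewrite !mxE.
have [Ju _] := mulmx1_unit (coframeK p).
by rewrite unitmx_mul unitmx_tr Ju.
Qed.

End HopfCylinder.

(** * The strip over the teardrop *)

Section OneVariable.
Context {R : realType}.
Implicit Types x t v : R.

(** An odd increasing bijection of the line onto ]-1, 1[. *)
Definition sigmoid t : R := 1 - 2 * (1 + expR t)^-1.

Let expR1_gt0 t : 0 < 1 + expR t.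
Proof. by rewrite ltr_wpDr // ltW // expR_gt0. Qed.

Lemma sigmoid_bound t : -1 < sigmoid t < 1.
Proof.
have e0 := expR_gt0 t; have i0 : 0 < (1 + expR t)^-1 by rewrite invr_gt0.
have : (1 + expR t)^-1 < 1 by rewrite invf_lt1 // ltrDl.
rewrite /sigmoid; lra.
Qed.

Lemma sigmoidN t : sigmoid (- t) = - sigmoid t.
Proof.
rewrite /sigmoid expRN; have := expR_gt0 t; move: (expR t) => e e0.
have [n1 n2] : e != 0 /\ 1 + e != 0 by split; apply: lt0r_neq0; lra.
have n3 : 1 + e^-1 != 0.
  by apply: lt0r_neq0; rewrite addr_gt0 // invr_gt0.
by field; rewrite ?n1 ?n2 ?n3 // addrC.
Qed.

Lemma sigmoidK t : ln (2 * (1 - sigmoid t)^-1 - 1) = t.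
Proof.
rewrite -[RHS]expRK; congr ln; rewrite /sigmoid.
have := expR_gt0 t; move: (expR t) => e e0.
have n1 : 1 + e != 0 by apply: lt0r_neq0; lra.
by field; rewrite n1 /=; apply: lt0r_neq0; lra.
Qed.

Lemma is_derive_sigmoid t :
  is_derive t 1 sigmoid (2 * expR t * ((1 + expR t) * (1 + expR t))^-1).
Proof.
have n0 : 1 + expR t != 0 by rewrite gt_eqF.
have d1 : is_derive t 1 (fun t => 1 + expR t) (0 + expR t).
  have [d dE] := @is_deriveD R R^o R^o (cst (1 : R)) expR t 1 _ _ _ _.
  by split; [exact: d|rewrite [LHS]dE].
have d2 := @is_deriveV R (fun t => 1 + expR t) t _ 1 n0 d1.
have [d3 d3E] := @is_deriveB R R^o R^o (cst (1 : R)) _ t 1 _ _ _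
  (@is_deriveZ R R^o R^o _ 2 t 1 _ d2).
split; first exact: d3.
rewrite [LHS]d3E /GRing.scale /=; field; exact: n0.
Qed.

(** A smooth odd function equal to the sign of x for |x| >= 1/2; the denominator
    is positive because 1/2 + x and 1/2 - x are not both nonpositive. *)
Definition smooth_sign x : R :=
  (flat_exp (2^-1 + x) - flat_exp (2^-1 - x)) /
  (flat_exp (2^-1 + x) + flat_exp (2^-1 - x)).

Lemma smooth_sign_denom x : 0 < flat_exp (2^-1 + x) + flat_exp (2^-1 - x).
Proof.
have ge0 y : 0 <= flat_exp y :> R.
  by have [/flat_exp_gt0/ltW//|y0] := ltP 0 y; rewrite /flat_exp flatpoly_le0.
have [x0|x0] := leP 0 x.
  by rewrite ltr_pwDl // flat_exp_gt0 //; lra.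
by rewrite ltr_wpDl // flat_exp_gt0 //; lra.
Qed.

Lemma smooth_signN x : smooth_sign (- x) = - smooth_sign x.
Proof.
by rewrite /smooth_sign opprK -mulNr opprB [in X in _ / X]addrC.
Qed.

Lemma smooth_sign1 x : 2^-1 <= x -> smooth_sign x = 1.
Proof.
move=> x2; have := smooth_sign_denom x.
rewrite /smooth_sign {2 4 6}/flat_exp flatpoly_le0; last lra.
by rewrite subr0 addr0 => /gt_eqF h; rewrite mulfV ?h.
Qed.

(** The ordinate of the teardrop, whose abscissa is v^2. *)
Definition loop v : R := v * flat_exp (1 - v * v).

Definition loop' v : R :=
  flat_exp (1 - v * v) - 2 * (v * v) * flat_exp' (1 - v * v).

Lemma loopN v : loop (- v) = - loop v.
Proof. by rewrite /loop mulrNN mulNr. Qed.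

Let is_derive_flat_square (P : {poly R}) v :
  is_derive v 1 (fun v => flatpoly P (1 - v * v))
   (flatpoly ('X^2 * (P - P^`())) (1 - v * v) * (- (2 * v))).
Proof.
have dq : is_derive v 1 (fun v : R => 1 - v * v) (- (2 * v)).
  have [d1 dE] := @is_deriveB R R^o R^o (cst (1 : R)) _ v 1 _ _ _
    (@is_deriveM R R^o id id v 1 _ _ _ _).
  split; first exact: d1.
  rewrite [LHS]dE /GRing.scale /=; ring.
have := @is_derive1_comp _ _ _ v _ _ (is_derive_flatpoly P (1 - v * v)) dq.
exact.
Qed.

Lemma is_derive_loop v : is_derive v 1 loop (loop' v).
Proof.
have [d dE] := @is_deriveM R R^o id _ v 1 _ _ _ (is_derive_flat_square 1 v).
split; first exact: d.
rewrite [LHS]dE /GRing.scale /= /loop' /flat_exp /flat_exp'; ring.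
Qed.

Lemma derivable_loop' v : derivable loop' v 1.
Proof.
have [d1 _] := is_derive_flat_square 1 v.
have [d2 _] := is_derive_flat_square ('X^2 * (1 - 1^`())) v.
have d3 : derivable (fun v : R => v * v) v 1.
  have did := @derivable_id R R^o v 1.
  exact: (@derivableM R R^o id id v 1 did did).
have d4 := @derivableM R R^o (cst (2 : R)) _ v 1 (@derivable_cst _ _ _ _ _ _) d3.
exact: (@derivableB R R^o R^o _ _ v 1 d1 (@derivableM R R^o _ _ v 1 d4 d2)).
Qed.

Lemma loop_outside v : 1 <= v * v -> loop v = 0 /\ loop' v = 0.
Proof.
move=> v1; rewrite /loop /loop' /flat_exp /flat_exp' !flatpoly_le0; [|lra..].
by rewrite !mulr0 subr0.
Qed.

End OneVariable.

Section Strip.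
Context {R : realType}.
Implicit Types p q : 'rV[R]_2.

Definition fiber_angle p : R := pi *+ 2 * p 0 0.

(** The parameter v of the teardrop at the point p = (s, t). The amplitude 3
    makes |v| < 1 imply |sin (pi s)| > 1/2, since |sigmoid| < 1. *)
Definition height p : R := 3 * cos (pi * p 0 0) + sigmoid (p 0 1).

Definition side p : R := smooth_sign (sin (pi * p 0 0)).

(** With [drop_im], the coordinates of the point W of the teardrop over which
    the image of p lies. *)
Definition drop_re p : R := height p * height p.

Definition drop_im p : R := side p * loop (height p).

Definition strip : 'rV[R]_2 -> 'rV[R]_4 := hopf_map fiber_angle drop_re drop_im.

(** On the loop |cos (pi s)| < 2/3, so sin (pi s) keeps away from the interval
    where [smooth_sign] varies. *)
Lemma side_locally_constant p : height p * height p < 1 ->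
  exists c, c * c = 1 /\
    \forall s \near p 0 0, smooth_sign (sin (pi * s)) = c.
Proof.
move=> h1; have b1 := sigmoid_bound (p 0 1).
pose x (s : R) := sin (pi * s).
have cx : {for p 0 0, continuous x}.
  apply: (continuous_comp (f := fun s : R => pi * s)); last exact: continuous_sin.
  by apply: continuousM; [exact: cst_continuous|exact: cvg_id].
have : 2^-1 < x (p 0 0) \/ x (p 0 0) < - 2^-1.
  have := cos2Dsin2 (pi * p 0 0); rewrite -/(x (p 0 0)) !expr2.
  move: h1; rewrite /height.
  move: (cos _) (x (p 0 0)) (sigmoid _) b1 => c s w b1 h1 cs.
  have c2 : - 2 / 3 < c < 2 / 3 by apply/andP; split; nra.
  have [s0|s0] := ltP 0 s; [left|right]; nra.
case=> xp; [exists 1|exists (-1)]; split; rewrite ?mulrNN ?mulr1 //.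
- near=> s; rewrite smooth_sign1 // ltW // -/(x s); near: s.
  exact: (cx [set y | 2^-1 < y] (lt_nbhsr xp)).
- near=> s; rewrite -[sin _]opprK smooth_signN smooth_sign1 //.
  rewrite lerNr ltW // -/(x s); near: s.
  exact: (cx [set y | y < - 2^-1] (lt_nbhsl xp)).
Unshelve. all: by end_near. Qed.

Lemma side_near p : height p * height p < 1 ->
  exists c, c * c = 1 /\ \forall q \near p, side q = c.
Proof.
move=> /side_locally_constant[c [cc sc]]; exists c; split=> //.
exact: (@coord_continuous R 1 2 0 0 p _ sc).
Qed.

Lemma height_elementary : elementary height.
Proof.
apply: elementaryD.
  apply: elementaryM; first exact: elementary_cst.
  apply: elementary_cos; apply: elementaryM; first exact: elementary_cst.
  exact: elementary_coord.
apply: elementaryB; first exact: elementary_cst.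
apply: elementaryM; first exact: elementary_cst.
have et : elementary (fun p : 'rV[R]_2 => expR (p 0 1)).
  exact/elementary_expR/elementary_coord.
apply: elementaryV; first by move=> p; rewrite gt_eqF // addr_gt0 // expR_gt0.
by apply: elementaryD => //; exact: elementary_cst.
Qed.

Lemma fiber_angle_elementary : elementary fiber_angle.
Proof. exact: (elementaryM (elementary_cst _) (elementary_coord _)). Qed.

Lemma side_elementary : elementary side.
Proof.
have es : elementary (fun p : 'rV[R]_2 => sin (pi * p 0 0)).
  exact/elementary_sin/(elementaryM (elementary_cst _) (elementary_coord _)).
have e1 : elementary (fun p : 'rV[R]_2 => flat_exp (2^-1 + sin (pi * p 0 0))).
  by apply: elementary_flatpoly; apply: elementaryD => //; exact: elementary_cst.
have e2 : elementary (fun p : 'rV[R]_2 => flat_exp (2^-1 - sin (pi * p 0 0))).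
  by apply: elementary_flatpoly; apply: elementaryB => //; exact: elementary_cst.
apply: elementaryM; first exact: elementaryB.
apply: elementaryV; last exact: elementaryD.
by move=> p; rewrite gt_eqF // smooth_sign_denom.
Qed.

Let square_elementary : elementary (fun p => height p * height p).
Proof. exact: (elementaryM height_elementary height_elementary). Qed.

Let loop_elementary : elementary (fun p => loop (height p)).
Proof.
apply: elementaryM; first exact: height_elementary.
apply: elementary_flatpoly; apply: elementaryB => //; exact: elementary_cst.
Qed.

Let loop'_elementary : elementary (fun p => loop' (height p)).
Proof.
have e1 : elementary (fun p => 1 - height p * height p).
  by apply: elementaryB => //; exact: elementary_cst.
apply: elementaryB; first exact: elementary_flatpoly.
apply: elementaryM; last exact: elementary_flatpoly.
by apply: elementaryM => //; exact: elementary_cst.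
Qed.

Definition drop_re' p : R := 2 * height p.

Definition drop_im' p : R := side p * loop' (height p).

Let partial_side i p : height p * height p < 1 -> partial i side p = 0.
Proof.
move=> /side_near [c [_ sc]]; rewrite /partial.
by rewrite (near_eq_derive (g := cst c) _ sc) derive_cst.
Qed.

Let partial_drop_re i p : partial i drop_re p = drop_re' p * partial i height p.
Proof.
rewrite /drop_re (partialM i height_elementary height_elementary) /drop_re'.
ring.
Qed.

(** The derivative of the sign vanishes on the loop, and the loop function
   vanishes outside it. *)
Let partial_drop_im i p : partial i drop_im p = drop_im' p * partial i height p.
Proof.
rewrite /drop_im (partialM i side_elementary loop_elementary) /drop_im'.
rewrite (partial_comp i height_elementary (fun q => is_derive_loop (height q))).
have [/partial_side ->|/loop_outside[-> _]] := ltP (height p * height p) 1;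
  ring.
Qed.

Let d_proportional_drop_re' : d_proportional height drop_re'.
Proof.
move=> p; exists 2 => i.
rewrite /drop_re' (partialM i (elementary_cst 2) height_elementary) partial_cst.
by rewrite mulr0 addr0.
Qed.

Let d_proportional_drop_im' : d_proportional height drop_im'.
Proof.
move=> p; exists (side p * 'D_1 (loop' : R -> R) (height p)) => i.
rewrite /drop_im' (partialM i side_elementary loop'_elementary).
rewrite (partial_comp i height_elementary
  (fun q => derivableP (@derivable_loop' R (height q)))).
have [/partial_side ->|/loop_outside[_ ->]] := ltP (height p * height p) 1;
  ring.
Qed.

(** The abscissa v^2 is stationary at v = 0 only, where the loop function has the
   nonzero slope exp(-1). *)
Let drop_regular p : 0 < drop_re' p * drop_re' p + drop_im' p * drop_im' p.
Proof.
rewrite /drop_re' /drop_im'; have [h0|h0] := eqVneq (height p) 0; last first.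
  by rewrite ltr_pwDl // -expr2 ?sqr_ge0 // exprn_even_gt0 //= mulf_neq0.
have h1 : height p * height p < 1 by rewrite h0 mul0r.
have [c [cc sc]] := side_near h1; rewrite (nbhs_singleton sc) (mulrACA c) cc.
rewrite h0 /loop' !(mul0r, mulr0, subr0) add0r mul1r.
by rewrite mulr_gt0 // flat_exp_gt0.
Qed.

Let partial_height p : 0 < partial 1 height p.
Proof.
have ec : elementary (fun p : 'rV[R]_2 => 3 * cos (pi * p 0 0)).
  apply: elementaryM; first exact: elementary_cst.
  exact/elementary_cos/(elementaryM (elementary_cst _) (elementary_coord _)).
have et : elementary (fun p : 'rV[R]_2 => sigmoid (p 0 1)).
  have -> : (fun p : 'rV[R]_2 => sigmoid (p 0 1)) =
      fun p => height p - 3 * cos (pi * p 0 0).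
    by apply/funext => q; rewrite /height addrAC subrr add0r.
  exact: (elementaryB height_elementary ec).
have es := elementary_coord (n := 2) (R := R).
rewrite /height (partialD 1 ec et).
have epi := elementaryM (elementary_cst (pi : R)) (es 0).
rewrite (partialM 1 (elementary_cst 3) (elementary_cos epi)) partial_cst.
rewrite (partial_comp 1 epi (fun q => is_derive_cos (pi * q 0 0))).
rewrite (partialM 1 (elementary_cst (pi : R)) (es 0)) partial_cst.
rewrite (partial_comp 1 (es 1) (fun q => is_derive_sigmoid (q 0 1))).
rewrite !partial_coord /= !(mulr0, mulr1, addr0, add0r).
have e0 := expR_gt0 (p 0 1).
have e1 : 0 < 1 + expR (p 0 1) by rewrite addr_gt0.
by rewrite !mulr_gt0 // invr_gt0 mulr_gt0.
Qed.

Let strip_nondegenerate p :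
  partial 0 fiber_angle p * partial 1 height p
  - partial 1 fiber_angle p * partial 0 height p != 0.
Proof.
have pu i : partial i fiber_angle p = pi *+ 2 * (0 == i)%:R.
  rewrite /fiber_angle.
  rewrite (partialM i (elementary_cst _) (elementary_coord 0)) partial_cst.
  by rewrite partial_coord mulr0 addr0.
rewrite !pu /= mulr0 mul0r subr0 mulr1 gt_eqF // mulr_gt0 //.
by rewrite mulrn_wgt0 // pi_gt0.
Qed.

Let drop_im_elementary : elementary drop_im.
Proof. exact: (elementaryM side_elementary loop_elementary). Qed.

Let drop_im'_elementary : elementary drop_im'.
Proof. exact: (elementaryM side_elementary loop'_elementary). Qed.

Let drop_re'_elementary : elementary drop_re'.
Proof. exact: (elementaryM (elementary_cst 2) height_elementary). Qed.

Lemma strip_smooth : smooth strip.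
Proof. by apply: hopf_map_smooth => //; exact: fiber_angle_elementary. Qed.

Lemma strip_immersion : immersion strip.
Proof.
apply: (@hopf_map_immersion _ _ height _ _ drop_re' drop_im') => //.
exact: fiber_angle_elementary.
Qed.

Lemma strip_flat : flat_metric (induced_metric strip).
Proof.
apply: (@hopf_map_flat _ _ height _ _ drop_re' drop_im') => //.
- exact: fiber_angle_elementary.
- exact: height_elementary.
Qed.

Lemma strip_sphere p : sphere R 4 (strip p).
Proof. exact: hopf_map_sphere. Qed.

(** The glide reflection changes the signs of v and of the side, which leaves v^2
    and the product of the side with the odd function loop unchanged, and turns
    the fiber by a full angle. *)
Lemma strip_glide1 p : strip (glide 1 p) = strip p.
Proof.
have g0 : glide 1 p 0 0 = p 0 0 + 1 by rewrite mxE.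
have g1 : glide 1 p 0 1 = - p 0 1 by rewrite mxE /= mulN1r.
have hN : height (glide 1 p) = - height p.
  by rewrite /height g0 g1 (mulrDr pi) mulr1 cosDpi sigmoidN; ring.
have sN : side (glide 1 p) = - side p.
  by rewrite /side g0 (mulrDr pi) mulr1 sinDpi smooth_signN.
have yE : drop_re (glide 1 p) = drop_re p by rewrite /drop_re hN mulrNN.
have zE : drop_im (glide 1 p) = drop_im p.
  by rewrite /drop_im hN sN loopN mulrNN.
have uE : fiber_angle (glide 1 p) = fiber_angle p + pi *+ 2.
  by rewrite /fiber_angle g0 (mulrDr (pi *+ 2)) mulr1.
have rE : hopf_scale drop_re drop_im (glide 1 p) = hopf_scale drop_re drop_im p.
  by rewrite /hopf_scale /hopf_norm2 yE zE.
by rewrite /strip /hopf_map rE yE zE uE sinD2pi cosD2pi.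
Qed.

Lemma strip_glide k p : strip (glide k p) = strip p.
Proof.
elim/int_rec: k => [|n IHn|n IHn]; first by rewrite glide0.
- by rewrite intS -glideD strip_glide1.
- by rewrite -strip_glide1 glideD intS opprD addrA subrr add0r.
Qed.

End Strip.

(** * Recovering a point of the plane from its image *)

Section Recover.
Context {R : realType}.
Variable p0 : 'rV[R]_2.

(** The filter of the initial topology of [strip] at p0, restricted to one
    fundamental domain of the glide reflection around p0. That it converges to
    p0 expresses both the injectivity of the map induced on the quotient and the
    continuity of its inverse. *)
Definition image_filter : set_system 'rV[R]_2 :=
  [set A | \forall x \near strip p0, forall q,
   strip q = x -> `|q 0 0 - p0 0 0| <= 2^-1 -> A q].

Local Notation G := image_filter.

Instance image_filter_filter : Filter G.
Proof.
split.
- by apply: (@nearW _ (nbhs (strip p0))) => x q _ _.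
- move=> A B; apply: (@filterS2 _ (nbhs (strip p0))) => x Ax Bx q qx sq.
  by split; [exact: Ax qx sq|exact: Bx qx sq].
- move=> A B AB; apply: (@filterS _ (nbhs (strip p0))) => x Ax q qx sq.
  by apply: AB; exact: Ax qx sq.
Qed.

(** With c algebraic in the coordinates of R^4, this is how v^2, the ordinate of
    the teardrop and the fiber angle modulo 2 pi are recovered. *)
Lemma cvg_image_filter (c : 'rV[R]_4 -> R) (f : 'rV[R]_2 -> R) :
  {for strip p0, continuous c} -> (forall q, c (strip q) = f q) ->
  f @ G --> f p0.
Proof.
move=> cc cf B; rewrite -cf => /cc Bc.
apply: (@filterS _ (nbhs (strip p0)) _ _ _ _ Bc) => x Bx q qx _.
by rewrite /= -cf qx.
Qed.

Let A (x : 'rV[R]_4) := x 0 0 * x 0 0 + x 0 1 * x 0 1.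

Let scale q : R := hopf_scale drop_re drop_im q.

Let stripE q : [/\ strip q 0 0 = scale q * cos (fiber_angle q),
  strip q 0 1 = scale q * sin (fiber_angle q),
  strip q 0 2 = scale q * (drop_re q * cos (fiber_angle q)
                           - drop_im q * sin (fiber_angle q)) &
  strip q 0 3 = scale q * (drop_re q * sin (fiber_angle q)
                           + drop_im q * cos (fiber_angle q))].
Proof. by split; rewrite mxE. Qed.

Let scale_gt0 q : 0 < scale q.
Proof. exact: hopf_scale_gt0. Qed.

Let AE q : A (strip q) = scale q * scale q.
Proof.
have [e0 e1 _ _] := stripE q; rewrite /A e0 e1.
have := cos2Dsin2 (fiber_angle q).
move: (cos _) (sin _) (scale q) => c s r cs.
have {}cs : c ^+ 2 = 1 - s ^+ 2 by rewrite -cs addrK.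
by ring: cs.
Qed.

Let A_gt0 q : 0 < A (strip q).
Proof. by rewrite AE mulr_gt0. Qed.

Let cj j : continuous (fun x : 'rV[R]_4 => x 0 j).
Proof. exact: coord_continuous. Qed.

Let cM (f g : 'rV[R]_4 -> R) x : {for x, continuous f} -> {for x, continuous g} ->
  {for x, continuous (fun x => f x * g x)}.
Proof. exact: continuousM. Qed.

Let cD (f g : 'rV[R]_4 -> R) x : {for x, continuous f} -> {for x, continuous g} ->
  {for x, continuous (fun x => f x + g x)}.
Proof. exact: continuousD. Qed.

Let cB (f g : 'rV[R]_4 -> R) x : {for x, continuous f} -> {for x, continuous g} ->
  {for x, continuous (fun x => f x - g x)}.
Proof. exact: continuousB. Qed.

Let cA : continuous A.
Proof. by move=> x; apply: cD; apply: cM; exact: cj. Qed.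

Let cV (f : 'rV[R]_4 -> R) x : f x != 0 -> {for x, continuous f} ->
  {for x, continuous (fun x => (f x)^-1)}.
Proof. by move=> f0 cf; apply: (@continuousV _ _ f). Qed.

Let drop_re_cvg : drop_re @ G --> drop_re p0.
Proof.
apply: (@cvg_image_filter
  (fun x => (x 0 0 * x 0 2 + x 0 1 * x 0 3) * (A x)^-1)).
  apply: cM; first by apply: cD; apply: cM; exact: cj.
  by apply: cV (@cA _); rewrite gt_eqF ?A_gt0.
move=> q; have [e0 e1 e2 e3] := stripE q; rewrite AE e0 e1 e2 e3.
have := cos2Dsin2 (fiber_angle q); have := scale_gt0 q.
move: (cos _) (sin _) (scale q) => c s r r0 cs.
have {}cs : c ^+ 2 = 1 - s ^+ 2 by rewrite -cs addrK.
rewrite -[RHS]mulr1 -(@mulfV _ (r * r)) ?mulf_neq0 ?gt_eqF // [RHS]mulrA.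
by congr (_ * _); ring: cs.
Qed.

Let drop_im_cvg : drop_im @ G --> drop_im p0.
Proof.
apply: (@cvg_image_filter
  (fun x => (x 0 0 * x 0 3 - x 0 1 * x 0 2) * (A x)^-1)).
  apply: cM; first by apply: cB; apply: cM; exact: cj.
  by apply: cV (@cA _); rewrite gt_eqF ?A_gt0.
move=> q; have [e0 e1 e2 e3] := stripE q; rewrite AE e0 e1 e2 e3.
have := cos2Dsin2 (fiber_angle q); have := scale_gt0 q.
move: (cos _) (sin _) (scale q) => c s r r0 cs.
have {}cs : c ^+ 2 = 1 - s ^+ 2 by rewrite -cs addrK.
rewrite -[RHS]mulr1 -(@mulfV _ (r * r)) ?mulf_neq0 ?gt_eqF // [RHS]mulrA.
by congr (_ * _); ring: cs.
Qed.

Let fiber_cvg :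
  cos (fiber_angle q - fiber_angle p0) @[q --> G] --> (1 : R).
Proof.
have -> : 1 = cos (fiber_angle p0 - fiber_angle p0) :> R by rewrite subrr cos0.
apply: (@cvg_image_filter (fun x => (x 0 0 * cos (fiber_angle p0) +
  x 0 1 * sin (fiber_angle p0)) * (Num.sqrt (A x))^-1)
  (fun q => cos (fiber_angle q - fiber_angle p0))).
  apply: cM.
    by apply: cD; apply: cM; (exact: cj || exact: cst_continuous).
  apply: cV; first by rewrite gt_eqF ?sqrtr_gt0 ?A_gt0.
  by apply: (continuous_comp (f := A)); [exact: cA|exact: sqrt_continuous].
move=> q; have [e0 e1 _ _] := stripE q; rewrite AE e0 e1.
have r0 := scale_gt0 q.
rewrite -expr2 sqrtr_sqr gtr0_norm // cosB.
rewrite -!mulrA -mulrDr mulrAC mulfV ?mul1r // gt_eqF //.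
Qed.

(** The image determines the fiber angle modulo 2 pi, through its cosine relative
   to p0, and the cosine is strictly decreasing on [0, pi]. *)
Let base_cvg : (fun q : 'rV[R]_2 => q 0 0) @ G --> p0 0 0.
Proof.
apply/cvgrPdist_lt => e e0.
pose d := Num.min e 2^-1.
have d0 : 0 < d by rewrite lt_min e0 invr_gt0 ltr0n.
have d2 : d <= 2^-1 by rewrite ge_min lexx orbT.
have pi0 := pi_gt0 R.
have inpi (x : R) : 0 <= x <= 2^-1 -> pi *+ 2 * x \in `[0, pi].
  move=> /andP[x0 x2]; rewrite in_itv /= mulr2n; nra.
have ltd (x : R) : `|x| <= 2^-1 ->
    (cos (pi *+ 2 * d) < cos (pi *+ 2 * x)) = (`|x| < d).
  move=> x2.
  rewrite -[cos (_ * x)]cos_norm normrM (@gtr0_norm _ (pi *+ 2)); last first.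
    by rewrite mulrn_wgt0.
  rewrite ltr_cos ?inpi ?normr_ge0 ?x2 ?d2 ?(ltW d0) //.
  by rewrite ltr_pM2l // mulrn_wgt0.
have cd1 : cos (pi *+ 2 * d) < 1.
  by have := ltd 0; rewrite normr0 mulr0 cos0 d0 => -> //; rewrite invr_ge0.
have dom : G [set q | `|q 0 0 - p0 0 0| <= 2^-1].
  by apply: (@filterE _ (nbhs (strip p0))) => x q _.
near=> q; rewrite distrC.
have q2 : `|q 0 0 - p0 0 0| <= 2^-1 by near: q; exact: dom.
apply: (@lt_le_trans _ _ d); last by rewrite ge_min lexx.
rewrite -ltd // mulrBr.
by near: q; exact: (fiber_cvg (lt_nbhsr cd1)).
Unshelve. all: by end_near. Qed.

Let core (q : 'rV[R]_2) : R := 3 * cos (pi * q 0 0).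

Let core_cvg : core @ G --> core p0.
Proof.
apply: cvgM; first exact: cvg_cst.
apply: (@continuous_cvg _ _ _ G _ (fun q : 'rV[R]_2 => pi * q 0 0) cos
  (pi * p0 0 0)); first exact: continuous_cos.
by apply: cvgM; [exact: cvg_cst|exact: base_cvg].
Qed.

Lemma loop_same_sign (v v0 : R) : 0 < loop v * loop v0 -> 0 < v * v0.
Proof.
have h0 y : 0 <= flat_exp y :> R.
  by have [/flat_exp_gt0/ltW//|y0] := ltP 0 y; rewrite /flat_exp flatpoly_le0.
rewrite /loop mulrACA => lt0; rewrite ltNge; apply/negP => le0.
by have := mulr_le0_ge0 le0 (mulr_ge0 (h0 (1 - v * v)) (h0 (1 - v0 * v0)));
  rewrite leNgt lt0.
Qed.

(** Two points of opposite heights on the stick, with |v| >= 1, are at distance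
    at least 2 in height, whereas two points on one transverse line s = const
    are at distance less than 2. The margin [d] accounts for the second point
    being only close to the transverse line of the first. *)
Lemma no_sign_change (v v0 w w0 c c0 d : R) :
  v = c + w -> v0 = c0 + w0 -> -1 < w < 1 -> 0 < d <= 4^-1 ->
  `|w0| <= 1 - 4 * d -> 1 <= v0 * v0 ->
  `|v0 * v0 - v * v| < d -> `|c0 - c| < d -> 0 < v * v0.
Proof.
wlog v00 : v v0 w w0 c c0 / 0 <= v0 => [H|].
  have [/H//|/ltW v00] := leP 0 v0; first exact.
  move=> ve v0e /andP[w1 w2] d4 w0b v01 vd cd; rewrite -mulrNN.
  apply: (H _ _ (- w) (- w0) (- c) (- c0)) => //.
  - by rewrite oppr_ge0.
  - by rewrite ve opprD.
  - by rewrite v0e opprD.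
  - by apply/andP; split; lra.
  - by rewrite normrN.
  - by rewrite mulrNN.
  - by rewrite !mulrNN.
  - by rewrite -opprD normrN.
move=> ve v0e /andP[w1 w2] /andP[d0 d4]; rewrite ler_norml => /andP[w01 w02].
move=> v01; rewrite !ltr_norml => /andP[vd1 vd2] /andP[cd1 cd2].
have v1 : 1 <= v0 by nra.
rewrite pmulr_lgt0; last lra.
rewrite ltNge; apply/negP => v0'.
have a1 : - v < v0 - 3 * d by lra.
nra.
Qed.

(** On the loop the sign of v is that of the ordinate, up to the locally constant
   side; on the stick the strip is too narrow to contain both signs. *)
Let height_same_sign : height p0 != 0 ->
  \forall q \near G, 0 < height q * height p0.
Proof.
move=> h0; have [h1|h1] := ltP (height p0 * height p0) 1.
  have [c [cc sc]] := side_locally_constant h1.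
  have l0 : 0 < drop_im p0 * drop_im p0.
    rewrite -expr2 exprn_even_gt0 //= mulf_neq0 //.
      rewrite /side (nbhs_singleton sc); apply/eqP => c0.
      by move/eqP: cc; rewrite c0 mul0r eq_sym oner_eq0.
    by rewrite mulf_neq0 // gt_eqF // flat_exp_gt0 // subr_gt0.
  have lim : drop_im q * drop_im p0 @[q --> G] --> drop_im p0 * drop_im p0.
    by apply: cvgM; [exact: drop_im_cvg|exact: cvg_cst].
  near=> q; apply: loop_same_sign.
  have sq : side q = c by near: q; exact: (base_cvg sc).
  have : 0 < drop_im q * drop_im p0 by near: q; exact: (lim _ (lt_nbhsr l0)).
  by rewrite /drop_im sq /side (nbhs_singleton sc) mulrACA cc mul1r.
have [w1 w2] := andP (sigmoid_bound (p0 0 1)).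
pose d := (1 - `|sigmoid (p0 0 1)|) / 4.
have d0 : 0 < d by rewrite divr_gt0 // subr_gt0 ltr_norml w1 w2.
near=> q.
apply: (@no_sign_change _ _ (sigmoid (q 0 1)) (sigmoid (p0 0 1))
  (core q) (core p0) d) => //.
- exact: sigmoid_bound.
- by rewrite d0 /d /=; have := normr_ge0 (sigmoid (p0 0 1)); lra.
- by rewrite /d; lra.
- by near: q; move/cvgrPdist_lt: drop_re_cvg; exact.
- by near: q; move/cvgrPdist_lt: core_cvg; exact.
Unshelve. all: by end_near. Qed.

(** The square of v converges and its sign is known, or its limit is 0. *)
Let height_cvg : height @ G --> height p0.
Proof.
apply/cvgrPdist_lt => e e0.
have [h0|h0] := eqVneq (height p0) 0.
  have ee : 0 < e * e by rewrite mulr_gt0.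
  near=> q; rewrite h0 sub0r normrN ltNge; apply/negP => he.
  have : `|drop_re p0 - drop_re q| < e * e.
    by near: q; move/cvgrPdist_lt: drop_re_cvg; exact.
  rewrite /drop_re h0 mulr0 sub0r normrN normrM; nra.
have n0 : 0 < `|height p0| by rewrite normr_gt0.
have en : 0 < e * `|height p0| by rewrite mulr_gt0.
near=> q.
have s0 : 0 < height q * height p0 by near: q; exact: height_same_sign.
have : `|drop_re p0 - drop_re q| < e * `|height p0|.
  by near: q; move/cvgrPdist_lt: drop_re_cvg; exact.
rewrite /drop_re => lt_e; rewrite -(ltr_pM2r n0); apply: le_lt_trans lt_e.
have -> : height p0 * height p0 - height q * height q =
  (height p0 - height q) * (height p0 + height q) by ring.
rewrite normrM ler_wpM2l //.
have [a|a] := ltP 0 (height p0).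
  have b : 0 < height q by rewrite -(pmulr_lgt0 _ a).
  rewrite !gtr0_norm //; lra.
have b : height q < 0 by nra.
rewrite !ler0_norm; lra.
Unshelve. all: by end_near. Qed.

Let fiber_coord_cvg : (fun q : 'rV[R]_2 => q 0 1) @ G --> p0 0 1.
Proof.
have wE (q : 'rV[R]_2) : sigmoid (q 0 1) = height q - core q.
  by rewrite /height addrAC subrr add0r.
have w1 : 1 - sigmoid (p0 0 1) != 0.
  by have /andP[_] := sigmoid_bound (p0 0 1); rewrite -subr_gt0 => /gt_eqF ->.
have wc : (fun q : 'rV[R]_2 => sigmoid (q 0 1)) @ G --> sigmoid (p0 0 1).
  suff <- : height - core = (fun q : 'rV[R]_2 => sigmoid (q 0 1)).
    by rewrite wE; exact: cvgB height_cvg core_cvg.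
  by apply/funext => q; rewrite wE.
pose arg (w : R) := 2 * (1 - w)^-1 - 1.
have ac : (fun q : 'rV[R]_2 => arg (sigmoid (q 0 1))) @ G -->
    arg (sigmoid (p0 0 1)).
  apply: cvgB; last exact: cvg_cst.
  apply: cvgM; first exact: cvg_cst.
  by apply: cvgV => //; apply: cvgB; [exact: cvg_cst|exact: wc].
have a0 : 0 < arg (sigmoid (p0 0 1)).
  rewrite /arg subr_gt0 ltr_pdivlMr.
    by have /andP[] := sigmoid_bound (p0 0 1); lra.
  by have /andP[] := sigmoid_bound (p0 0 1); lra.
have argK : @ln R \o (fun q : 'rV[R]_2 => arg (sigmoid (q 0 1))) =
    fun q : 'rV[R]_2 => q 0 1.
  by apply/funext => q; rewrite /= /arg sigmoidK.
have := @continuous_cvg _ _ _ G _ (fun q : 'rV[R]_2 => arg (sigmoid (q 0 1)))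
  (@ln R) _ (continuous_ln a0) ac.
rewrite argK /arg sigmoidK. exact.
Qed.

Lemma image_filter_cvg : G --> p0.
Proof.
apply: (@cvg_row _ _ _ G _ id) => j.
have [->|->] : j = 0 \/ j = 1.
- by case: j => -[|[|//]] ?; [left|right]; apply/val_inj.
- exact: base_cvg.
- exact: fiber_coord_cvg.
Qed.

End Recover.

(** * Descent to the Moebius strip *)

Section Descent.
Local Open Scope quotient_scope.
Context {R : realType}.

Definition moebius_strip (m : moebius R) : 'rV[R]_4 :=
  strip (repr (m : {eq_quot moebius_equiv R})).

Lemma moebius_piE (p q : 'rV[R]_2) :
  moebius_pi p = moebius_pi q <-> exists k, q = glide k p.
Proof.
have eqE := @eqmodP _ (moebius_equiv R) p q.
split=> [|[k ->]]; first by move/eqE/asboolP.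
by apply/eqmodP/asboolP; exists k.
Qed.

Lemma moebius_pi_repr (m : moebius R) :
  moebius_pi (repr (m : {eq_quot moebius_equiv R})) = m.
Proof. exact: reprK. Qed.

Lemma in_coord_moebius_strip : in_coord moebius_strip = strip.
Proof.
apply/funext => p; rewrite /in_coord /moebius_strip.
have /moebius_piE[k {2}->] := moebius_pi_repr (moebius_pi p).
by rewrite strip_glide.
Qed.

(** The glides translate s by any integer, so s can be brought within 1/2 of any
    value. *)
Lemma moebius_representative (p0 : 'rV[R]_2) (m : moebius R) :
  exists2 q, moebius_pi q = m & `|q 0 0 - p0 0 0| <= 2^-1.
Proof.
pose p := repr (m : {eq_quot moebius_equiv R}).
pose k := Num.floor (p0 0 0 - p 0 0 + 2^-1).
exists (glide k p).
  rewrite -[RHS](moebius_pi_repr m); symmetry; apply/moebius_piE.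
  by exists k.
rewrite mxE /= ler_norml.
have := floor_itv (p0 0 0 - p 0 0 + 2^-1); rewrite intrD -/k => /andP[k1 k2].
apply/andP; split; lra.
Qed.

(** If q and p0 have the same image, q lies in every set of the image filter
    at p0, hence in every neighborhood of p0. *)
Lemma moebius_strip_injective : injective moebius_strip.
Proof.
move=> m m' mm'.
have [p0 p0m] : exists p, moebius_pi p = m.
  by exists (repr (m : {eq_quot moebius_equiv R})); exact: moebius_pi_repr.
have [q qm q2] := moebius_representative p0 m'.
have sq : strip q = strip p0.
  by rewrite -in_coord_moebius_strip /in_coord qm p0m.
rewrite -p0m -qm; congr moebius_pi; apply: contrapT => p0q.
have U : nbhs p0 (~` [set q]).
  apply: open_nbhs_nbhs; split; last by move=> /= pq; apply: p0q; rewrite pq.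
  apply: closed_openC; apply: accessible_closed_set1.
  exact/hausdorff_accessible/norm_hausdorff.
have /nbhs_singleton/(_ q sq q2) := image_filter_cvg U.
exact.
Qed.

Lemma moebius_strip_embedding : topological_embedding moebius_strip.
Proof.
split; first exact: moebius_strip_injective.
move=> U; split=> [oU|[V oV <-]]; last first.
  have cs : continuous moebius_strip.
    apply/(@quotient_continuous _ {eq_quot moebius_equiv R}).
    have -> : moebius_strip \o \pi_(_) = strip by exact: in_coord_moebius_strip.
    by have [] := strip_smooth (R := R) 0.
  by move/continuousP: cs; exact.
(* The largest open set whose preimage is contained in U; it contains the image
   of U because the image filters converge. *)
exists ([set x | forall m, moebius_strip m = x -> U m]^°).
  exact: open_interior.
apply/seteqP; split=> m /=; first by move=> /interior_subset; exact.
move=> Um; pose p0 := repr (m : {eq_quot moebius_equiv R}).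
have Up0 : nbhs p0 (@moebius_pi R @^-1` U).
  by apply: open_nbhs_nbhs; split => //=; rewrite moebius_pi_repr.
apply: (@filterS _ (nbhs (strip p0))) (image_filter_cvg Up0) => x Ux m' m'x.
have [q qm' q2] := moebius_representative p0 m'.
rewrite -qm'; apply: Ux q2.
by rewrite -in_coord_moebius_strip /in_coord qm'.
Qed.

End Descent.

Theorem mainTheorem7 (R : realType) :
  exists f : moebius R -> 'rV[R]_4,
    [/\ smooth_embedding f,
        range f `<=` sphere R 4
      & flat_metric (induced_metric (in_coord f))].
Proof.
exists moebius_strip; split.
- split; rewrite ?in_coord_moebius_strip.
  + exact: strip_smooth.
  + exact: strip_immersion.
  + exact: moebius_strip_embedding.
- by move=> _ [m _ <-]; exact: strip_sphere.
- by rewrite in_coord_moebius_strip; exact: strip_flat.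
Qed.
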